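(* In the block construction described in the context (a one-dimensional geometrically local ansatz circuit of constant depth $d$ with a product input state, $m=\Theta(n)$ kept blocks $B_1,\dots,B_m$ of fixed size $b=O(1)$, and buffers of size $g>\ell$), the buffer-erased ansatz distribution factorizes: $$\bar q_n(x_1,\dots,x_m)=\prod_{i=1}^m q_i(x_i)\qquad\text{for all } x_i\in\{0,1\}^{B_i}.$$ Assume moreover that there exist constants $\chi\ge 0$ and $c>0$ such that $$\bar p_n(x_1,\dots,x_m)\le e^{\chi m}\prod_{i=1}^m p_i(x_i)\quad\text{for all }x_i\in\{0,1\}^{B_i},\qquad\text{and}\qquad \frac1m\sum_{i=1}^m D_{1/2}(p_i\Vert q_i)-\chi\ \ge\ c .$$ Then $$B(p_n,q_n)\le e^{-cm/2}=e^{-\Omega(n)},$$ and consequently $$\Gamma^\star(p_n\mid q_n)\ge e^{2cm}=e^{\Omega(n)} .$$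
   Context: Distributions. $p_n(s)=|\langle s|\phi_0\rangle|^2$ is the computational-basis Born distribution on $\{0,1\}^n$ of a target $n$-qubit state $|\phi_0\rangle$, and $q_n(s)=|\langle s|\psi\rangle|^2$ that of the ansatz state $|\psi\rangle$ obtained by applying a one-dimensional geometrically local unitary circuit of constant depth $d$ (each gate acts on $O(1)$ neighbouring qubits on a line) to a product input state. Block construction. $\ell=O(d)$ denotes the backward light-cone scale of the circuit, meaning that any two sets of qubits separated by more than $\ell$ sites have disjoint backward light cones. Choose kept blocks $B_1,\dots,B_m$ of fixed size $b=O(1)$, with $m=\Theta(n)$, separated by buffer regions of size $g>\ell$. Let $R$ be the classical erasure map that marginalizes out all qubits outside $\bigcup_i B_i$: $$(Rp)(x_1,\dots,x_m)=\sum_{y}p(x_1,\dots,x_m,y),\qquad x_i\in\{0,1\}^{B_i},$$ $y$ ranging over all discarded (buffer) bits. Put $\bar p_n=Rp_n$, $\bar q_n=Rq_n$, and let $p_i$, $q_i$ be the marginals of $\bar p_n$, $\bar q_n$ on block $B_i$. Quantities. $B(p,q)=\sum_s\sqrt{p(s)q(s)}$ is the Bhattacharyya coefficient, and $D_{1/2}(p\Vert q)=-2\log B(p,q)$ (natural logarithm; $+\infty$ if $B(p,q)=0$) is the Rényi-$1/2$ divergence. The exact DNP (diagonal non-unitary post-processing) dynamic range is $$\Gamma^\star(p\mid q)=\inf_w\left\{\frac{\max_s w(s)}{\min_s w(s)}: w:\{0,1\}^n\to(0,\infty),\ p(s)=\frac{w(s)q(s)}{\sum_t w(t)q(t)}\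 \text{for all } s\right\},$$ equal to $+\infty$ if no such $w$ exists. The constants $\chi,c$ (and $b,d,\ell$) do not depend on $n$. *)

(* Defs.v *)
From HB Require Import structures.
From mathcomp Require Import all_boot all_order all_algebra.
From mathcomp Require Import complex.
From mathcomp Require Import boolp classical_sets reals ereal topology.
From mathcomp Require Import normedtype sequences landau exp.

Set Implicit Arguments.
Unset Strict Implicit.
Unset Printing Implicit Defensive.

Import Order.TTheory GRing.Theory Num.Theory.
Import numFieldNormedType.Exports.

Local Open Scope ring_scope.

Definition bits (n : nat) := {ffun 'I_n -> bool}.

(* The sites wstart, ..., wstart + k - 1 of a line of n qubits. *)
Record window (n k : nat) := Window {
  wstart : nat;
  wfit : (wstart + k <= n)%N }.

Definition wsite n k (w : window n k) (j : 'I_k) : 'I_n :=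
  widen_ord (wfit w) (rshift (wstart w) j).

Definition wsupp n k (w : window n k) : {set 'I_n} :=
  [set i in codom (wsite w)]%SET.

Definition wread n k (w : window n k) (s : bits n) : bits k :=
  [ffun j => s (wsite w j)].

Definition state (R : realType) (n : nat) := {ffun bits n -> R[i]}.

Definition normalized (R : realType) (T : finType) (v : T -> R[i]) : Prop :=
  \sum_s `|v s| ^+ 2 = 1.

Definition product_state (R : realType) n (v : 'I_n -> bool -> R[i]) :
  state R n := [ffun s : bits n => \prod_i v i (s i)].

(* [Re] only changes the type: [`|z| ^+ 2] is a real element of [R[i]]. *)
Definition born (R : realType) n (psi : state R n) (s : bits n) : R :=
  complex.Re (`|psi s| ^+ 2).

Record gate (R : realType) (n : nat) := Gate {
  gwidth : nat;
  gwin : window n gwidth;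
  gmat : 'M[R[i]]_#|bits gwidth|;
  gmat_unitary : gmat \is unitarymx }.

Definition gsupp R n (G : gate R n) : {set 'I_n} := wsupp (gwin G).

(* The action of the gate's matrix on its window, tensored with the identity
   on the other qubits. *)
Definition apply_gate R n (psi : state R n) (G : gate R n) : state R n :=
  [ffun s : bits n => \sum_(t : bits n | [forall j, (j \notin gsupp G) ==> (t j == s j)])
     gmat G (enum_rank (wread (gwin G) s)) (enum_rank (wread (gwin G) t))
       * psi t].

(* A circuit is a sequence of layers, the head layer being applied first. *)
Definition circuit (R : realType) (n : nat) := seq (seq (gate R n)).

Definition run R n (C : circuit R n) (psi : state R n) : state R n :=
  foldl (foldl (@apply_gate R n)) psi C.

Definition local_circuit R n (r d : nat) (C : circuit R n) : Prop :=
  [/\ size C = d,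
      all (pairwise (fun G H => [disjoint gsupp G & gsupp H])) C
    & all (all (fun G => gwidth G <= r)%N) C].

Definition layer_cone R n (L : seq (gate R n)) (A : {set 'I_n}) : {set 'I_n} :=
  (A :|: \big[@finset.setU _/finset.set0]_(G <- L | ~~ [disjoint gsupp G & A])
           gsupp G)%SET.

Definition light_cone R n (C : circuit R n) (A : {set 'I_n}) : {set 'I_n} :=
  foldr (@layer_cone R n) A C.

(* More than l sites lie strictly between any site of A and any site of A'. *)
Definition separated n (l : nat) (A A' : {set 'I_n}) : Prop :=
  forall i j : 'I_n, i \in A -> j \in A' ->
    (i + l.+1 < j)%N || (j + l.+1 < i)%N.

Definition light_cone_scale R n (l : nat) (C : circuit R n) : Prop :=
  forall A A' : {set 'I_n}, separated l A A' ->
    [disjoint light_cone C A & light_cone C A'].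

(* m blocks of b consecutive sites, consecutive blocks being separated by
   exactly g buffer sites; the sites before the first block and after the last
   one are discarded as well. *)
Record block_layout (n m b g : nat) := BlockLayout {
  boffset : nat;
  bfit : forall i : 'I_m, (boffset + i * (b + g) + b <= n)%N }.

Definition block n m b g (B : block_layout n m b g) (i : 'I_m) : window n b :=
  Window (bfit B i).

Definition blocks_read n m b g (B : block_layout n m b g) (s : bits n) :
  {ffun 'I_m -> bits b} := [ffun i => wread (block B i) s].

(* The sum over the discarded bits, written as the sum over all n-bit strings
   with prescribed kept bits. *)
Definition erase (R : realType) n m b g (B : block_layout n m b g)
    (p : bits n -> R) (x : {ffun 'I_m -> bits b}) : R :=
  \sum_(s : bits n | blocks_read B s == x) p s.

Definition block_marginal (R : realType) m b
    (p : {ffun 'I_m -> bits b} -> R) (i : 'I_m) (z : bits b) : R :=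
  \sum_(x : {ffun 'I_m -> bits b} | x i == z) p x.

Definition bhattacharyya (R : realType) (T : finType) (p q : T -> R) : R :=
  \sum_s Num.sqrt (p s * q s).

Definition renyi_half (R : realType) (T : finType) (p q : T -> R) : \bar R :=
  if bhattacharyya p q == 0 then +oo%E else (- 2 * ln (bhattacharyya p q))%:E.

Definition zero_bits n : bits n := [ffun=> false].

Definition max_weight (R : realType) n (w : bits n -> R) : R :=
  \big[Num.max/w (zero_bits n)]_s w s.

Definition min_weight (R : realType) n (w : bits n -> R) : R :=
  \big[Num.min/w (zero_bits n)]_s w s.

Definition dnp_weight (R : realType) n (p q w : bits n -> R) : Prop :=
  (forall s, 0 < w s) /\
  (forall s, p s = w s * q s / \sum_t w t * q t).

Definition dnp_dynamic_range (R : realType) n (p q : bits n -> R) : \bar R :=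
  ereal_inf [set x : \bar R | exists w : bits n -> R,
    dnp_weight p q w /\ x = (max_weight w / min_weight w)%:E]%classic.

(* Main.v *)
Require Import Defs.
From HB Require Import structures.
From mathcomp Require Import all_boot all_order all_algebra.
From mathcomp Require Import complex.
From mathcomp Require Import zify ring lra.
From mathcomp Require Import boolp classical_sets reals ereal topology.
From mathcomp Require Import normedtype sequences landau exp.

(* Work in the Heisenberg picture. A gate whose support misses that of an
   observable commutes with it, hence cancels when the observable is pulled back
   through the circuit; so the pull-back is supported on the light cone, and a
   product state gives independent values to observables with disjoint supports.
   This makes the erased ansatz distribution a product. The Bhattacharyya
   coefficient does not decrease under erasure (Cauchy-Schwarz) and is
   multiplicative over products, and a weight with max/min ratio K keeps it at
   least K^(-1/4), which turns the bound on it into a bound on the range. *)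

Set Implicit Arguments.
Unset Strict Implicit.
Unset Printing Implicit Defensive.

Import Order.TTheory GRing.Theory Num.Theory.
Import numFieldNormedType.Exports.

Local Open Scope ring_scope.

(** * Observables and their supports *)

(** Flipping row and column by one mask [z] that vanishes on [A] is how [supported] expresses that
    an operator ignores the qubits off [A]. *)
Definition xorb_bits n (s z : bits n) : bits n := [ffun i => s i (+) z i].

Lemma xorb_bitsK n (z : bits n) : involutive (fun s => xorb_bits s z).
Proof. by move=> s; apply/ffunP => i; rewrite !ffunE addbK. Qed.

Definition merge n (A : {set 'I_n}) (s t : bits n) : bits n :=
  [ffun i => if i \in A then s i else t i].

Definition op (R : realType) n := bits n -> bits n -> R[i].

Definition opmul (R : realType) n (X Y : op R n) : op R n :=
  fun s t => \sum_u X s u * Y u t.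

Definition opadj (R : realType) n (X : op R n) : op R n := fun s t => (X t s)^*.

(** The projector of a computational-basis event; [op_event R predT] serves as the identity
    operator. *)
Definition op_event (R : realType) n (E : pred (bits n)) : op R n :=
  fun s t => ((s == t) && E s)%:R.

Definition inner (R : realType) n (u v : bits n -> R[i]) : R[i] := \sum_s (u s)^* * v s.

Definition op_act (R : realType) n (X : op R n) (u : bits n -> R[i]) : bits n -> R[i] :=
  fun s => \sum_t X s t * u t.

Definition expect (R : realType) n (psi : bits n -> R[i]) (X : op R n) : R[i] :=
  inner psi (op_act X psi).

(* [X] acts as the identity on the qubits outside [A]: it neither changes them nor
   depends on their values. *)
Definition supported (R : realType) n (A : {set 'I_n}) (X : op R n) : Prop :=
  (forall (s t : bits n) i, i \notin A -> s i != t i -> X s t = 0) /\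
  (forall z s t : bits n, {in A, forall i, z i = false} ->
     X (xorb_bits s z) (xorb_bits t z) = X s t).

Definition determined_on n (A : {set 'I_n}) (E : pred (bits n)) : Prop :=
  forall s t : bits n, {in A, s =1 t} -> E s = E t.

Lemma opmulA (R : realType) n (X Y Z : op R n) :
  opmul X (opmul Y Z) = opmul (opmul X Y) Z.
Proof.
apply/funext => s; apply/funext => t; rewrite /opmul.
under eq_bigr do rewrite big_distrr /=.
rewrite exchange_big /=; apply: eq_bigr => v _; rewrite big_distrl /=.
by apply: eq_bigr => u _; rewrite mulrA.
Qed.

Lemma op_event_mul (R : realType) n (E F : pred (bits n)) :
  opmul (op_event R E) (op_event R F) = op_event R (predI E F).
Proof.
apply/funext => s; apply/funext => t; rewrite /opmul (bigD1 s) //=.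
rewrite big1 => [|u /negPf us]; last by rewrite /op_event eq_sym us mul0r.
by rewrite addr0 /op_event eqxx -natrM mulnb andbCA.
Qed.

Lemma op1mul (R : realType) n (X : op R n) : opmul (op_event R predT) X = X.
Proof.
apply/funext => s; apply/funext => t; rewrite /opmul (bigD1 s) //=.
rewrite big1 => [|u /negPf us]; last by rewrite /op_event eq_sym us mul0r.
by rewrite /op_event eqxx mul1r addr0.
Qed.

Lemma supported_sub (R : realType) n (A B : {set 'I_n}) (X : op R n) :
  A \subset B -> supported A X -> supported B X.
Proof.
move=> /fintype.subsetP AB [X0 Xz]; split=> [s t i iB|z s t zB].
  by apply: X0; apply: contra iB; apply: AB.
by apply: Xz => i /AB; apply: zB.
Qed.

Lemma supported_mul (R : realType) n (A : {set 'I_n}) (X Y : op R n) :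
  supported A X -> supported A Y -> supported A (opmul X Y).
Proof.
move=> [X0 Xz] [Y0 Yz]; split=> [s t i iA st|z s t zA].
  apply: big1 => u _; case: (eqVneq (s i) (u i)) => su.
    by rewrite (Y0 u t i) ?mulr0 // -su.
  by rewrite (X0 s u i) ?mul0r.
rewrite /opmul (reindex_inj (inv_inj (@xorb_bitsK n z))) /=.
by apply: eq_bigr => u _; rewrite Xz // Yz.
Qed.

Lemma supported_adj (R : realType) n (A : {set 'I_n}) (X : op R n) :
  supported A X -> supported A (opadj X).
Proof.
move=> [X0 Xz]; split=> [s t i iA st|z s t zA].
  by rewrite /opadj (X0 t s i) ?conjC0 // eq_sym.
by rewrite /opadj Xz.
Qed.

Lemma supported_event (R : realType) n (A : {set 'I_n}) (E : pred (bits n)) :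
  determined_on A E -> supported A (op_event R E).
Proof.
move=> EA; split=> [s t i iA|z s t zA].
  by apply: contraNeq; rewrite /op_event pnatr_eq0 eqb0 !negbK => /andP[/eqP ->].
rewrite /op_event (inj_eq (inv_inj (@xorb_bitsK n z))).
by rewrite (EA _ s) // => i iA; rewrite ffunE zA // addbF.
Qed.

(* The support conditions leave a single nonzero term in the sum. *)
Lemma opmul_disjointE (R : realType) n (A : {set 'I_n}) (X Y : op R n) s t :
  supported A X -> supported (~: A) Y ->
  opmul X Y s t = X s (merge A t s) * Y (merge A t s) t.
Proof.
move=> [X0 _] [Y0 _]; rewrite /opmul (bigD1 (merge A t s)) //=.
rewrite big1 ?addr0 // => u us.
have [ i ] : exists i, u i != merge A t s i.
  apply/existsP; rewrite -negb_forall; apply: contra us => /forallP ut.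
  by apply/eqP/ffunP => i; apply/eqP.
rewrite ffunE; case: ifP => iA ui.
  by rewrite (Y0 u t i) ?mulr0 // inE iA.
by rewrite (X0 s u i) ?mul0r ?iA // eq_sym.
Qed.

(** Each of the two products has a single term, and flips that [X] or [Y] cannot see carry one term
    to the other. *)
Lemma op_disjointC (R : realType) n (A : {set 'I_n}) (X Y : op R n) :
  supported A X -> supported (~: A) Y -> opmul X Y = opmul Y X.
Proof.
move=> XA YA; apply/funext => s; apply/funext => t.
rewrite (opmul_disjointE _ _ XA YA) (opmul_disjointE _ _ YA) ?finset.setCK //.
have [[_ Xz] [_ Yz]] := (XA, YA); rewrite mulrC; congr (_ * _).
  (* The mask flips the bits of [A] where [s] and [t] differ: it sends [merge A t s] to [s], and [t]
     to the string equal to [s] on [A] and to [t] elsewhere. *)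
  rewrite -(Yz (merge A (xorb_bits s t) [ffun=> false])).
    by congr (Y _ _); apply/ffunP => i; rewrite !ffunE ?inE;
      case: (i \in A); case: (s i); case: (t i).
  by move=> i; rewrite inE ffunE => /negPf ->; rewrite ffunE.
rewrite -(Xz (merge A [ffun=> false] (xorb_bits s t))).
  by congr (X _ _); apply/ffunP => i; rewrite !ffunE ?inE;
    case: (i \in A); case: (s i); case: (t i).
by move=> i iA; rewrite ffunE iA ffunE.
Qed.

(** * Gates and light cones *)

Lemma op_act_mul (R : realType) n (X Y : op R n) (u : bits n -> R[i]) :
  op_act (opmul X Y) u = op_act X (op_act Y u).
Proof.
apply/funext => s; rewrite /op_act /opmul.
under eq_bigr do rewrite big_distrl /=.
rewrite exchange_big /=; apply: eq_bigr => t _; rewrite big_distrr /=.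
by apply: eq_bigr => a _; rewrite mulrA.
Qed.

Lemma inner_adj (R : realType) n (X : op R n) (u v : bits n -> R[i]) :
  inner (op_act X u) v = inner u (op_act (opadj X) v).
Proof.
rewrite /inner /op_act; under eq_bigr do rewrite rmorph_sum big_distrl /=.
rewrite exchange_big /=; apply: eq_bigr => t _; rewrite big_distrr /=.
by apply: eq_bigr => s _; rewrite rmorphM /= /opadj mulrA [_^* * _^*]mulrC.
Qed.

Lemma wsite_inj n k (w : window n k) : injective (wsite w).
Proof.
by move=> i j /(congr1 val) /= /addnI ij; apply/val_inj.
Qed.

Lemma mem_wsupp n k (w : window n k) j : wsite w j \in wsupp w.
Proof. by rewrite inE codom_f. Qed.

Lemma eq_wread n k (w : window n k) (s t : bits n) :
  {in wsupp w, s =1 t} -> wread w s = wread w t.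
Proof. by move=> st; apply/ffunP => j; rewrite !ffunE st ?mem_wsupp. Qed.

Definition wwrite n k (w : window n k) (s : bits n) (z : bits k) : bits n :=
  [ffun i => if [pick j | wsite w j == i] is Some j then z j else s i].

Lemma wwriteK n k (w : window n k) s : cancel (wwrite w s) (wread w).
Proof.
move=> z; apply/ffunP => j; rewrite !ffunE.
by case: pickP => [a /eqP /wsite_inj -> //|/(_ j)]; rewrite eqxx.
Qed.

Lemma wwrite_out n k (w : window n k) s z i :
  i \notin wsupp w -> wwrite w s z i = s i.
Proof.
rewrite inE ffunE; case: pickP => // j /eqP <-.
by rewrite codom_f.
Qed.

Lemma wreadK n k (w : window n k) (s u : bits n) :
  (forall i, i \notin wsupp w -> u i = s i) -> wwrite w s (wread w u) = u.
Proof.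
move=> us; apply/ffunP => i; rewrite ffunE.
case: pickP => [j /eqP <-|ji]; first by rewrite ffunE.
by rewrite us // inE; apply/negP => /codomP[j ij]; have := ji j; rewrite ij eqxx.
Qed.

(** [wwrite w s] and [wread w] are inverse bijections between window contents and the strings that
    agree with [s] off the window. *)
Lemma sum_wread (V : nmodType) n k (w : window n k) (s : bits n)
    (F : bits k -> V) :
  \sum_(u : bits n | [forall j, (j \notin wsupp w) ==> (u j == s j)])
    F (wread w u) = \sum_z F z.
Proof.
rewrite (reindex_onto (wwrite w s) (wread w)) /= => [|u /forallP us].
  rewrite (eq_bigl predT) => [|z]; first by apply: eq_bigr => z _; rewrite wwriteK.
  rewrite wwriteK eqxx andbT; apply/forallP => j; apply/implyP => jw.
  by rewrite wwrite_out.
by apply: wreadK => i iw; apply/eqP; apply: (implyP (us i)).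
Qed.

Definition gate_op (R : realType) n (G : gate R n) : op R n := fun s t =>
  if [forall j, (j \notin gsupp G) ==> (t j == s j)]
  then gmat G (enum_rank (wread (gwin G) s)) (enum_rank (wread (gwin G) t))
  else 0.

Lemma apply_gateE (R : realType) n (psi : state R n) (G : gate R n) :
  apply_gate psi G = op_act (gate_op G) psi :> (bits n -> R[i]).
Proof.
apply/funext => s; rewrite ffunE big_mkcond; apply: eq_bigr => t _.
by rewrite /gate_op; case: ifP; rewrite ?mul0r.
Qed.

Lemma supported_gate (R : realType) n (G : gate R n) : supported (gsupp G) (gate_op G).
Proof.
split=> [s t i iG st|z s t zG].
  rewrite /gate_op ifN //; apply/forallPn; exists i.
  by rewrite iG eq_sym.
have rd u : wread (gwin G) (xorb_bits u z) = wread (gwin G) u.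
  by apply: eq_wread => i iG; rewrite ffunE zG // addbF.
rewrite /gate_op !rd; congr (if _ then _ else _); apply: eq_forallb => j.
by rewrite !ffunE (inj_eq (@addIb _)).
Qed.

(** The adjoint is again a gate, so that [G^* G = 1] will follow from [G G^* = 1]. *)
Definition adj_gate (R : realType) n (G : gate R n) : gate R n :=
  Gate (gwin G) (etrans (trmxC_unitary (gmat G)) (gmat_unitary G)).

Lemma gate_op_adj (R : realType) n (G : gate R n) :
  gate_op (adj_gate G) = opadj (gate_op G).
Proof.
apply/funext => s; apply/funext => t; rewrite /opadj /gate_op /=.
have -> : [forall j, (j \notin gsupp (adj_gate G)) ==> (t j == s j)] =
          [forall j, (j \notin gsupp G) ==> (s j == t j)].
  by apply: eq_forallb => j; rewrite eq_sym.
by case: ifP; rewrite ?conjC0 // !mxE.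
Qed.

Lemma gate_op_mul_adj (R : realType) n (G : gate R n) :
  opmul (gate_op G) (opadj (gate_op G)) = op_event R predT.
Proof.
apply/funext => s; apply/funext => t; rewrite /op_event andbT.
have [[K0 _] [K0' _]] :=
  (supported_gate G, supported_adj (supported_gate G)).
(* If [s] and [t] differ off the window, no intermediate string agrees with both there. Otherwise
   the sum is an inner product of two rows of the unitary matrix. *)
have [st|] := boolP [forall j, (j \notin gsupp G) ==> (t j == s j)]; last first.
  case/forallPn => i; rewrite negb_imply => /andP[iG ts].
  rewrite (negPf (_ : s != t)); last by apply: contra ts => /eqP ->.
  apply: big1 => u _; have [su|su] := eqVneq (s i) (u i).
    by rewrite (K0' u t i) ?mulr0 // -su eq_sym.
  by rewrite (K0 s u i) ?mul0r.
pose M := gmat G; pose rk u := enum_rank (wread (gwin G) u).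
transitivity (\sum_(z : bits (gwidth G)) M (rk s) (enum_rank z) *
               (M (rk t) (enum_rank z))^*).
  rewrite -(sum_wread (gwin G) s) [RHS]big_mkcond /=; apply: eq_bigr => u _.
  rewrite /opadj /gate_op.
  have -> : [forall j, (j \notin gsupp G) ==> (u j == t j)] =
            [forall j, (j \notin gsupp G) ==> (u j == s j)].
    apply: eq_forallb => j; move/forallP/(_ j): st; case: (j \in gsupp G) => //=.
    by move=> /eqP ->.
  by case: ifP; rewrite ?mul0r.
have /matrixP/(_ (rk s) (rk t)) := unitarymxP (gmat_unitary G).
rewrite !mxE (reindex _ (onW_bij _ (@enum_rank_bij _))) /=.
under eq_bigr do rewrite !mxE.
move=> ->; rewrite (inj_eq enum_rank_inj); congr (_%:R); congr nat_of_bool.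
(* Equal window contents, together with agreement off the window, give [s = t]. *)
apply/eqP/eqP => [rst|-> //].
rewrite -(wreadK (w := gwin G) (s := s) (u := t)) => [|i iG].
  by rewrite -rst wreadK.
by apply/eqP; move/forallP/(_ i)/implyP: st; apply.
Qed.

Lemma opadjK (R : realType) n (X : op R n) : opadj (opadj X) = X.
Proof. by apply/funext => s; apply/funext => t; rewrite /opadj conjCK. Qed.

Lemma gate_op_adj_mul (R : realType) n (G : gate R n) :
  opmul (opadj (gate_op G)) (gate_op G) = op_event R predT.
Proof. by have := gate_op_mul_adj (adj_gate G); rewrite gate_op_adj opadjK. Qed.

Definition pull_gate (R : realType) n (G : gate R n) (X : op R n) : op R n :=
  opmul (opadj (gate_op G)) (opmul X (gate_op G)).

(** Heisenberg evolution: [run] is a [foldl], so the last layer and its last gate conjugate the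
    observable first, in the order in which [light_cone] grows. *)
Definition pull (R : realType) n (C : circuit R n) (X : op R n) : op R n :=
  foldr (fun L Y => foldr (@pull_gate R n) Y L) X C.

Lemma expect_apply_gate (R : realType) n (psi : state R n) (G : gate R n) (X : op R n) :
  expect (apply_gate psi G) X = expect psi (pull_gate G X).
Proof. by rewrite /expect apply_gateE inner_adj -!op_act_mul -opmulA. Qed.

Lemma expect_run (R : realType) n (C : circuit R n) (psi : state R n) (X : op R n) :
  expect (run C psi) X = expect psi (pull C X).
Proof.
have layerE L (phi : state R n) Y :
    expect (foldl (@apply_gate R n) phi L) Y =
    expect phi (foldr (@pull_gate R n) Y L).
  by elim: L phi => //= G L IH phi; rewrite IH expect_apply_gate.
by rewrite /run; elim: C psi => //= L C IH psi; rewrite IH layerE.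
Qed.

Lemma pull_gate1 (R : realType) n (G : gate R n) :
  pull_gate G (op_event R predT) = op_event R predT.
Proof. by rewrite /pull_gate op1mul gate_op_adj_mul. Qed.

(** Conjugation by a unitary is multiplicative: the inner factor [G G^*] is the identity. *)
Lemma pull_gateM (R : realType) n (G : gate R n) (X Y : op R n) :
  pull_gate G (opmul X Y) = opmul (pull_gate G X) (pull_gate G Y).
Proof.
rewrite /pull_gate -!opmulA; congr (opmul _ (opmul _ _)).
by rewrite [RHS]opmulA gate_op_mul_adj op1mul.
Qed.

Lemma pull1 (R : realType) n (C : circuit R n) :
  pull C (op_event R predT) = op_event R predT.
Proof.
elim: C => //= L C ->; elim: L => //= G L ->; exact: pull_gate1.
Qed.

Lemma pullM (R : realType) n (C : circuit R n) (X Y : op R n) :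
  pull C (opmul X Y) = opmul (pull C X) (pull C Y).
Proof.
elim: C => //= L C ->; elim: L => //= G L ->; exact: pull_gateM.
Qed.

(* A gate acting away from [A] commutes with the observable and cancels. *)
Lemma pull_gate_disjoint (R : realType) n (A : {set 'I_n}) (G : gate R n) (X : op R n) :
  [disjoint gsupp G & A] -> supported A X -> pull_gate G X = X.
Proof.
move=> GA XA; have KA : supported (~: A) (gate_op G).
  by apply: supported_sub (supported_gate G); rewrite -finset.disjoints_subset.
by rewrite /pull_gate (op_disjointC XA KA) opmulA gate_op_adj_mul op1mul.
Qed.

Lemma supported_pull_gate (R : realType) n (A : {set 'I_n}) (G : gate R n)
    (X : op R n) :
  gsupp G \subset A -> supported A X -> supported A (pull_gate G X).
Proof.
move=> GA XA; have KA := supported_sub GA (supported_gate G).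
by apply: supported_mul (supported_mul XA KA); apply: supported_adj.
Qed.

(** A gate meeting [A] is absorbed into the cone. A gate missing [A] also misses the other gates of
    its layer, hence everything absorbed so far, and it cancels; this is why [layer_cone] may test
    gates against [A] alone. *)
Lemma supported_pull_layer (R : realType) n (A : {set 'I_n})
    (L : seq (gate R n)) (X : op R n) :
  pairwise (fun G H => [disjoint gsupp G & gsupp H]) L ->
  supported A X -> supported (layer_cone L A) (foldr (@pull_gate R n) X L).
Proof.
move=> + XA; elim: L => [|G L IH] /=.
  by rewrite /layer_cone big_nil finset.setU0.
case/andP => GL /IH; rewrite /layer_cone big_cons; set U := \big[_/_]_(_ <- L | _) _.
move=> YA; case: ifPn => [_|GA].
  apply: supported_pull_gate; last apply: supported_sub YA.
    by rewrite finset.setUCA finset.subsetUl.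
  by rewrite finset.setUS // finset.subsetUr.
rewrite (pull_gate_disjoint _ YA) //; rewrite negbK in GA.
rewrite fintype.disjoint_sym finset.disjoints_subset finset.subUset.
rewrite -!finset.disjoints_subset fintype.disjoint_sym GA /= {YA}/U; elim: L GL {IH} => [|H L IH] /=.
  by rewrite big_nil finset.disjoints_subset finset.sub0set.
case/andP => GH GL; rewrite big_cons; case: ifP => _; last exact: IH.
rewrite finset.disjoints_subset finset.subUset -!finset.disjoints_subset IH // andbT.
by rewrite fintype.disjoint_sym.
Qed.

Lemma supported_pull (R : realType) n (A : {set 'I_n}) (C : circuit R n) (X : op R n) :
  all (pairwise (fun G H => [disjoint gsupp G & gsupp H])) C ->
  supported A X -> supported (light_cone C A) (pull C X).
Proof.
move=> + XA; elim: C => //= L C IH /andP[L_disj C_disj].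
by apply: supported_pull_layer => //; apply: IH.
Qed.

(** * Product inputs and independence *)

Lemma product_state_merge (R : realType) n (v : 'I_n -> bool -> R[i])
    (A : {set 'I_n}) (s t : bits n) :
  product_state v (merge A s t) * product_state v (merge A t s) =
  product_state v s * product_state v t.
Proof.
rewrite !ffunE -!big_split; apply: eq_bigr => i _ /=.
by rewrite !ffunE; case: ifP => // _; rewrite mulrC.
Qed.

Lemma product_state_normalized (R : realType) n (v : 'I_n -> bool -> R[i]) :
  (forall i, normalized (v i)) -> inner (product_state v) (product_state v) = 1.
Proof.
move=> v1; rewrite /inner.
transitivity (\sum_(s : bits n) \prod_i `|v i (s i)| ^+ 2).
  apply: eq_bigr => s _; rewrite !ffunE rmorph_prod -big_split /=.
  by apply: eq_bigr => i _; rewrite normCK mulrC.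
rewrite -(bigA_distr_bigA (fun i b => `|v i b| ^+ 2)) /=.
by apply: big1 => i _; apply: v1.
Qed.

Lemma expectE (R : realType) n (u : bits n -> R[i]) (X : op R n) :
  expect u X = \sum_(p : bits n * bits n) (u p.1)^* * X p.1 p.2 * u p.2.
Proof.
rewrite -(pair_bigA _ (fun s t => (u s)^* * X s t * u t)) /=.
apply: eq_bigr => s _; rewrite big_distrr /=.
by apply: eq_bigr => t _; rewrite mulrA.
Qed.

(* Two independent copies of a product state are unchanged when they exchange
   their [A]-parts; after the exchange the second copy contributes only its
   norm. *)
Lemma expect_product_state (R : realType) n (v : 'I_n -> bool -> R[i])
    (A : {set 'I_n}) (X Y : op R n) :
  (forall i, normalized (v i)) -> supported A X -> supported (~: A) Y ->
  expect (product_state v) (opmul X Y) =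
  expect (product_state v) X * expect (product_state v) Y.
Proof.
move=> v1 XA YA; set u := product_state v.
have [[X0 Xz] [Y0 Yz]] := (XA, YA).
(* Each copy carries a pair of a row and a column index, and [swap] mixes rows with rows and columns
   with columns. *)
pose swap (q : (bits n * bits n) * (bits n * bits n)) :=
  ((merge A q.1.1 q.2.1, merge A q.1.2 q.2.2),
   (merge A q.2.1 q.1.1, merge A q.2.2 q.1.2)).
have mergeK s t : merge A (merge A s t) (merge A t s) = s.
  by apply/ffunP => i; rewrite !ffunE; case: (i \in A).
have swapK : involutive swap.
  by case=> -[s t] [s' t']; rewrite /swap /= !mergeK.
(* [X] forces [s'] and [t'] to agree off [A], and [Y] forces it on [A]. Once they are equal, flips
   bring both factors to the single term of [opmul X Y s t]. *)
have XY s t s' t' :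
    X (merge A s s') (merge A t t') * Y (merge A s' s) (merge A t' t) =
    opmul X Y s t *+ (s' == t').
  rewrite (opmul_disjointE _ _ XA YA); case: eqVneq => [->|st] /=; last first.
    have [ i sti] : exists i, s' i != t' i.
      apply/existsP; rewrite -negb_forall; apply: contra st => /forallP st.
      by apply/eqP/ffunP => i; apply/eqP.
    have [iA|iA] := boolP (i \in A).
      by rewrite (Y0 _ _ i) ?mulr0 // ?inE ?ffunE iA.
    by rewrite (X0 _ _ i) ?mul0r // !ffunE (negPf iA).
  rewrite mulr1n -(Xz (merge A [ffun=> false] (xorb_bits s t'))); last first.
    by move=> i iA; rewrite ffunE iA ffunE.
  rewrite -(Yz (merge A (xorb_bits t t') [ffun=> false])); last first.
    by move=> i; rewrite inE ffunE => /negPf ->; rewrite ffunE.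
  by congr (X _ _ * Y _ _); apply/ffunP => i; rewrite !ffunE;
    case: (i \in A); case: (s i); case: (t i); case: (t' i).
rewrite !expectE big_distrlr /= pair_bigA /= (reindex_inj (inv_inj swapK)) /=.
transitivity (\sum_(p : bits n * bits n) \sum_(p' : bits n * bits n)
  ((u p.1)^* * opmul X Y p.1 p.2 * u p.2) *
  ((u p'.1)^* * u p'.2 *+ (p'.1 == p'.2))); last first.
  rewrite [LHS]pair_bigA; apply: eq_bigr => -[[s t] [s' t']] _ /=.
  transitivity ((u (merge A s s') * u (merge A s' s))^* *
    (u (merge A t t') * u (merge A t' t)) *
    (X (merge A s s') (merge A t t') * Y (merge A s' s) (merge A t' t))).
    rewrite XY !product_state_merge rmorphM /= -!/u.
    case: eqVneq => _; last by rewrite !mulr0n !mulr0.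
    by rewrite !mulr1n; ring.
  by rewrite rmorphM /=; ring.
rewrite -big_distrlr /= [X in _ * X](_ : _ = 1) ?mulr1 //.
rewrite -(pair_bigA _ (fun s t => (u s)^* * u t *+ (s == t))) /=.
rewrite -(product_state_normalized v1); apply: eq_bigr => s _.
rewrite (bigD1 s) //= eqxx mulr1n big1 ?addr0 // => t.
by rewrite eq_sym => /negPf ->.
Qed.

Lemma expect_event (R : realType) n (psi : state R n) (E : pred (bits n)) :
  expect psi (op_event R E) = (\sum_(s | E s) born psi s)%:C%C.
Proof.
rewrite rmorph_sum /= big_mkcond; apply: eq_bigr => s _.
rewrite /op_act (bigD1 s) //= big1 ?addr0 => [|t ts]; last first.
  by rewrite /op_event eq_sym (negPf ts) mul0r.
rewrite /op_event eqxx /= /born; case: ifP => _; last by rewrite mul0r mulr0.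
by rewrite mul1r mulrC -normCK RRe_real ?realX ?normr_real.
Qed.

(** The total mass is the expectation of the identity, which pulling back fixes. *)
Lemma sum_born_run (R : realType) n (C : circuit R n) (v : 'I_n -> bool -> R[i]) :
  (forall i, normalized (v i)) -> \sum_s born (run C (product_state v)) s = 1.
Proof.
move=> v1; apply: complexI; rewrite -(expect_event _ predT) expect_run pull1.
rewrite /expect (_ : op_act _ _ = product_state v) ?product_state_normalized //.
apply/funext => s; rewrite /op_act (bigD1 s) //= big1 ?addr0 => [|t ts].
  by rewrite /op_event eqxx mul1r.
by rewrite /op_event eq_sym (negPf ts) mul0r.
Qed.

(** The projector of a joint event is a product of projectors, and the two factors pull back to
    observables supported on disjoint light cones. *)
Lemma born_run_indep (R : realType) n (C : circuit R n)
    (v : 'I_n -> bool -> R[i]) (A A' : {set 'I_n}) (E F : pred (bits n)) :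
  all (pairwise (fun G H => [disjoint gsupp G & gsupp H])) C ->
  (forall i, normalized (v i)) ->
  [disjoint light_cone C A & light_cone C A'] ->
  determined_on A E -> determined_on A' F ->
  \sum_(s | E s && F s) born (run C (product_state v)) s =
  (\sum_(s | E s) born (run C (product_state v)) s) *
  (\sum_(s | F s) born (run C (product_state v)) s).
Proof.
move=> C_disj v1 AA' EA FA'; apply: complexI; rewrite rmorphM /=.
rewrite -(expect_event _ (predI E F)) -!expect_event !expect_run.
rewrite -op_event_mul pullM.
apply: (expect_product_state (A := light_cone C A)) => //.
  exact: supported_pull (supported_event _ EA).
apply: supported_sub (supported_pull C_disj (supported_event _ FA')).
by rewrite -finset.disjoints_subset fintype.disjoint_sym.
Qed.

(** * Block layouts and factorization of the erased distribution *)

Lemma block_separated n m b g l (B : block_layout n m b g) (i i' : 'I_m) j j' :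
  (l < g)%N -> i != i' -> j \in wsupp (block B i) -> j' \in wsupp (block B i') ->
  (j + l.+1 < j')%N || (j' + l.+1 < j)%N.
Proof.
move=> lg + /[!inE] /codomP[k ->] /codomP[k' ->].
wlog ii' : i i' k k' / (i < i')%N => [hw|_].
  move=> ne; have := ne; rewrite -val_eqE /= neq_ltn => /orP[|] lt_i.
    exact: hw.
  by rewrite orbC; apply: hw; rewrite // eq_sym.
rewrite /=; apply/orP; left.
(* The last site of a block and the first site of the next one differ by [g + 1], which exceeds
   [l.+1] because [l < g]. *)
have := ltn_ord k.
have : (i.+1 * (b + g) <= i' * (b + g))%N by rewrite leq_mul2r ii' orbT.
rewrite mulSn; lia.
Qed.

(** Blocks are peeled off one at a time. Pairwise independence would not suffice: [indep] is applied
    to one block against the union of the remaining ones, from which it is separated site by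
    site. *)
Lemma erase_prod (R : realType) n m b g l (B : block_layout n m b g)
    (q : bits n -> R) (x : {ffun 'I_m -> bits b}) :
  (l < g)%N -> \sum_s q s = 1 ->
  (forall (A A' : {set 'I_n}) (E F : pred (bits n)),
     Defs.separated l A A' -> determined_on A E -> determined_on A' F ->
     \sum_(s | E s && F s) q s = (\sum_(s | E s) q s) * (\sum_(s | F s) q s)) ->
  erase B q x = \prod_(i < m) block_marginal (erase B q) i (x i).
Proof.
move=> lg q1 indep.
pose E i (s : bits n) := wread (block B i) s == x i.
have marg i : block_marginal (erase B q) i (x i) = \sum_(s | E i s) q s.
  rewrite (partition_big (blocks_read B) (fun y => y i == x i)) => [|s] /=; last first.
    by rewrite ffunE.
  apply: eq_bigr => y /eqP yi; apply: eq_bigl => s.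
  by rewrite /E -yi; case: eqP => [<-|]; rewrite ?andbF // ffunE eqxx.
have joint (r : seq 'I_m) : uniq r ->
    \sum_(s | all (fun i => E i s) r) q s = \prod_(i <- r) \sum_(s | E i s) q s.
  elim: r => [_|i r IH /= /andP[ir r_uniq]]; first by rewrite big_nil.
  rewrite big_cons -IH //.
  apply: (indep (wsupp (block B i))
    [set j | has (fun i' => j \in wsupp (block B i')) r]%SET).
  - move=> j j' ji /[!inE] /hasP[i' i'r ji'].
    by apply: block_separated ji ji' => //; apply: contraNneq ir => ->.
  - by move=> s t st; rewrite /E (eq_wread st).
  move=> s t st; apply: eq_in_all => i' i'r; rewrite /E (@eq_wread _ _ _ s t) //.
  by move=> j ji'; apply: st; rewrite inE; apply/hasP; exists i'.
under eq_bigr do rewrite marg.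
rewrite -big_enum -joint ?enum_uniq //; apply: eq_bigl => s.
apply/eqP/allP => [xs i _|xs]; first by rewrite /E -xs ffunE.
by apply/ffunP => i; rewrite ffunE; apply/eqP/xs; rewrite mem_enum.
Qed.

(** * Bhattacharyya coefficients and dynamic range *)

Lemma sqrtr_prod (R : realType) (I : finType) (F : I -> R) :
  (forall i, 0 <= F i) -> Num.sqrt (\prod_i F i) = \prod_i Num.sqrt (F i).
Proof.
move=> F0; suff [_] : 0 <= \prod_i F i /\
    Num.sqrt (\prod_i F i) = \prod_i Num.sqrt (F i) by [].
elim/big_rec2: _ => [|i y x _ [x0 IH]]; first by rewrite ler01 sqrtr1.
by rewrite sqrtrM // IH mulr_ge0.
Qed.

Lemma sqrtr_expR (R : realType) (x : R) : Num.sqrt (expR x) = expR (x / 2).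
Proof.
by rewrite [in LHS](splitr x) expRD -expr2 sqrtr_sqr ger0_norm.
Qed.

(** Cauchy-Schwarz, adding one term at a time; each addition is the two-term inequality. *)
Lemma ler_sum_sqrt (R : realType) (T : finType) (P : pred T) (p q : T -> R) :
  (forall s, 0 <= p s) -> (forall s, 0 <= q s) ->
  \sum_(s | P s) Num.sqrt (p s * q s) <=
  Num.sqrt ((\sum_(s | P s) p s) * (\sum_(s | P s) q s)).
Proof.
move=> p0 q0.
suff [] : [/\ 0 <= \sum_(s | P s) p s, 0 <= \sum_(s | P s) q s &
  \sum_(s | P s) Num.sqrt (p s * q s) <=
  Num.sqrt ((\sum_(s | P s) p s) * (\sum_(s | P s) q s))] by [].
elim/big_rec3: _ => [|s z y x _ [x0 y0 xyz]]; first by rewrite mul0r sqrtr0.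
split; [exact: addr_ge0 | exact: addr_ge0 |].
apply: le_trans (lerD (lexx _) xyz) _.
rewrite (sqrtrM _ (p0 s)) (sqrtrM _ x0).
rewrite -[leLHS]ger0_norm ?addr_ge0 ?mulr_ge0 ?sqrtr_ge0 // -sqrtr_sqr.
apply: ler_wsqrtr.
rewrite -{2}(sqr_sqrtr (p0 s)) -{2}(sqr_sqrtr (q0 s)).
rewrite -{2}(sqr_sqrtr x0) -{2}(sqr_sqrtr y0).
move: (Num.sqrt (p s)) (Num.sqrt (q s)) (Num.sqrt x) (Num.sqrt y) => a b a' b'.
(* Lagrange's identity for [(a^2 + a'^2)(b^2 + b'^2) - (a b + a' b')^2]. *)
rewrite -subr_ge0 (_ : _ - _ = (a * b' - a' * b) ^+ 2) ?sqr_ge0 //; ring.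
Qed.

Lemma bhattacharyya_ge0 (R : realType) (T : finType) (p q : T -> R) :
  0 <= bhattacharyya p q.
Proof. by apply: sumr_ge0 => s _; apply: sqrtr_ge0. Qed.

(** Cauchy-Schwarz on each fibre of the erasure map. *)
Lemma bhattacharyya_erase (R : realType) n m b g (B : block_layout n m b g)
    (p q : bits n -> R) :
  (forall s, 0 <= p s) -> (forall s, 0 <= q s) ->
  bhattacharyya p q <= bhattacharyya (erase B p) (erase B q).
Proof.
move=> p0 q0; rewrite /bhattacharyya (partition_big (blocks_read B) predT) //=.
by apply: ler_sum => x _; apply: ler_sum_sqrt.
Qed.

Lemma bhattacharyya_prod (R : realType) (I T : finType) (p q : I -> T -> R) :
  (forall i z, 0 <= p i z) -> (forall i z, 0 <= q i z) ->
  bhattacharyya (fun x : {ffun I -> T} => \prod_i p i (x i))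
                (fun x => \prod_i q i (x i)) =
  \prod_i bhattacharyya (p i) (q i).
Proof.
move=> p0 q0; rewrite /bhattacharyya bigA_distr_bigA; apply: eq_bigr => x _ /=.
by rewrite -big_split sqrtr_prod // => i; apply: mulr_ge0.
Qed.

Lemma bhattacharyya_le (R : realType) (T : finType) (k : R) (p p' q : T -> R) :
  0 <= k -> (forall s, 0 <= q s) -> (forall s, p s <= k * p' s) ->
  bhattacharyya p q <= Num.sqrt k * bhattacharyya p' q.
Proof.
move=> k0 q0 pp'; rewrite /bhattacharyya mulr_sumr; apply: ler_sum => s _.
by rewrite -sqrtrM // ler_wsqrtr // mulrA ler_wpM2r.
Qed.

Lemma prod_bhattacharyya_le (R : realType) (m : nat) (T : finType)
    (p q : 'I_m -> T -> R) (a : R) :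
  0 < a ->
  (a%:E <= ((m%:R : R)^-1)%:E * \sum_(i < m) renyi_half (p i) (q i))%E ->
  \prod_(i < m) bhattacharyya (p i) (q i) <= expR (- (a * m%:R / 2)).
Proof.
move=> a0.
(* A vanishing coefficient makes its divergence [+oo], but then the product is zero. Otherwise all
   divergences are real and the product is the exponential of a sum of logarithms. *)
have [/existsP[i /eqP Bi] _|B0] :=
    boolP [exists i, bhattacharyya (p i) (q i) == 0].
  by rewrite (bigD1 i) //= Bi mul0r expR_ge0.
have {}B0 i : bhattacharyya (p i) (q i) != 0.
  by apply: contraNneq B0 => Bi; apply/existsP; exists i; rewrite Bi.
rewrite (eq_bigr (fun i => (- 2 * ln (bhattacharyya (p i) (q i)))%:E)); last first.
  by move=> i _; rewrite /renyi_half (negPf (B0 i)).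
rewrite sumEFin -EFinM lee_fin -mulr_sumr => aD.
(* For [m = 0] the convention [0^-1 = 0] makes the average zero, contradicting [0 < a]. *)
have m0 : 0 < m%:R :> R.
  rewrite lt_neqAle ler0n andbT eq_sym; apply: contraTneq aD => ->.
  by rewrite invr0 mul0r -ltNge.
have -> : \prod_(i < m) bhattacharyya (p i) (q i) =
          expR (\sum_(i < m) ln (bhattacharyya (p i) (q i))).
  rewrite expR_sum; apply: eq_bigr => i _; rewrite lnK // posrE.
  by rewrite lt_neqAle eq_sym B0 bhattacharyya_ge0.
rewrite ler_expR; move: aD; rewrite ler_pdivlMl //; lra.
Qed.

Lemma min_weight_le (R : realType) n (w : bits n -> R) s : min_weight w <= w s.
Proof. exact: bigmin_le_cond. Qed.

Lemma max_weight_ge (R : realType) n (w : bits n -> R) s : w s <= max_weight w.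
Proof. exact: le_bigmax_cond. Qed.

Lemma min_weight_gt0 (R : realType) n (w : bits n -> R) :
  (forall s, 0 < w s) -> 0 < min_weight w.
Proof. by move=> w0; apply: lt_bigmin. Qed.

(* With [u := sqrt w], [B^2 = (E_q u)^2 / E_q u^2], where [E_q u^2 <= max u * E_q u]
   and [E_q u >= min u]. *)
Lemma dnp_weight_bhattacharyya (R : realType) n (p q w : bits n -> R) :
  (forall s, 0 <= q s) -> \sum_s q s = 1 -> dnp_weight p q w ->
  min_weight w <= bhattacharyya p q ^+ 4 * max_weight w.
Proof.
move=> q0 q1 [w0 pE].
pose Z := \sum_t w t * q t; pose U := \sum_t Num.sqrt (w t) * q t.
have min0 := min_weight_gt0 w0.
have max0 : 0 <= max_weight w.
  exact: le_trans (ltW (w0 (zero_bits n))) (max_weight_ge _ _).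
have minU : Num.sqrt (min_weight w) <= U.
  rewrite -[leLHS]mulr1 -q1 mulr_sumr; apply: ler_sum => s _.
  by rewrite ler_wpM2r // ler_wsqrtr // min_weight_le.
have ZU : Z <= Num.sqrt (max_weight w) * U.
  rewrite mulr_sumr; apply: ler_sum => s _.
  rewrite -{1}(sqr_sqrtr (ltW (w0 s))) expr2 -mulrA ler_wpM2r ?mulr_ge0 ?sqrtr_ge0 //.
  by rewrite ler_wsqrtr // max_weight_ge.
have Z0 : 0 < Z.
  apply: lt_le_trans min0 _; rewrite -[leLHS]mulr1 -q1 mulr_sumr.
  by apply: ler_sum => s _; rewrite ler_wpM2r // min_weight_le.
have U0 : 0 < U by apply: lt_le_trans minU; rewrite sqrtr_gt0.
have BE : bhattacharyya p q ^+ 2 = U ^+ 2 / Z.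
  suff -> : bhattacharyya p q = U / Num.sqrt Z by rewrite expr_div_n sqr_sqrtr // ltW.
  rewrite /bhattacharyya /U mulr_suml; apply: eq_bigr => s _.
  rewrite pE -/Z (_ : _ * _ = w s * (q s ^+ 2 * Z^-1)); last by rewrite expr2; ring.
  rewrite sqrtrM ?ltW // sqrtrM ?sqr_ge0 // sqrtr_sqr ger0_norm // sqrtrV ?ltW //.
  by rewrite mulrA.
have UZ : U <= bhattacharyya p q ^+ 2 * Num.sqrt (max_weight w).
  rewrite BE mulrAC ler_pdivlMr // expr2 -mulrA ler_pM2l //.
  by rewrite [leRHS]mulrC.
(* It remains to square the chain [sqrt min <= U <= B^2 * sqrt max], whence the fourth power. *)
rewrite -(sqr_sqrtr (ltW min0)) -[X in _ * X](sqr_sqrtr max0).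
rewrite (_ : _ * _ = (bhattacharyya p q ^+ 2 * Num.sqrt (max_weight w)) ^+ 2).
  rewrite ler_sqr ?nnegrE ?mulr_ge0 ?bhattacharyya_ge0 ?sqrtr_ge0 //.
  exact: le_trans minU UZ.
by rewrite exprMn -exprM.
Qed.

(** Every admissible weight has ratio at least [B^-4], hence the factor 4. If there is none, the
    infimum over the empty set is [+oo] and the bound still holds. *)
Lemma dnp_dynamic_range_ge (R : realType) n (p q : bits n -> R) (a : R) :
  (forall s, 0 <= q s) -> \sum_s q s = 1 -> bhattacharyya p q <= expR (- a) ->
  ((expR (4 * a))%:E <= dnp_dynamic_range p q)%E.
Proof.
move=> q0 q1 Ba; apply: le_ereal_inf_tmp => _ [w [w_pq ->]].
have min0 := min_weight_gt0 w_pq.1.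
rewrite lee_fin ler_pdivlMr //.
apply: le_trans (ler_wpM2l (expR_ge0 _) (dnp_weight_bhattacharyya q0 q1 w_pq)) _.
rewrite mulrA; apply: ler_piMl.
  apply: le_trans (ltW (w_pq.1 (zero_bits n))) (max_weight_ge _ _).
have B4 : bhattacharyya p q ^+ 4 <= expR (- (4 * a)).
  by rewrite -mulrN expRM_natl lerXn2r ?nnegrE ?bhattacharyya_ge0 ?expR_ge0.
apply: le_trans (ler_wpM2l (expR_ge0 _) B4) _.
by rewrite -expRD addrN expR0.
Qed.

(** * Assembly of the bounds and their exponential rates *)

Lemma born_ge0 (R : realType) n (psi : state R n) (s : bits n) : 0 <= born psi s.
Proof. by rewrite -ler0c /born RRe_real ?realX ?normr_real // exprn_ge0. Qed.

Lemma erase_ge0 (R : realType) n m b g (B : block_layout n m b g) (p : bits n -> R) x :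
  (forall s, 0 <= p s) -> 0 <= erase B p x.
Proof. by move=> p0; apply: sumr_ge0. Qed.

Lemma block_marginal_ge0 (R : realType) m b
    (p : {ffun 'I_m -> bits b} -> R) i z :
  (forall x, 0 <= p x) -> 0 <= block_marginal p i z.
Proof. by move=> p0; apply: sumr_ge0. Qed.

(** Replacing the erased target by the product of its marginals costs [expR (chi * m / 2)]. The
    product of block coefficients is at most [expR (- (c + chi) * m / 2)], so [chi] cancels. *)
Lemma bhattacharyya_blocks_le (R : realType) n m b g (B : block_layout n m b g)
    (p q : bits n -> R) (chi c : R) :
  let pm := block_marginal (erase B p) in
  let qm := block_marginal (erase B q) in
  (forall s, 0 <= p s) -> (forall s, 0 <= q s) -> 0 <= chi -> 0 < c ->
  (forall x, erase B q x = \prod_(i < m) qm i (x i)) ->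
  (forall x, erase B p x <= expR (chi * m%:R) * \prod_(i < m) pm i (x i)) ->
  (c%:E <= ((m%:R : R)^-1)%:E * (\sum_(i < m) renyi_half (pm i) (qm i)) - chi%:E)%E ->
  bhattacharyya p q <= expR (- (c * m%:R / 2)).
Proof.
move=> pm qm p0 q0 chi0 c0 q_prod p_le; rewrite leeBrDr // -EFinD => c_le.
have pm0 i z : 0 <= pm i z by apply: block_marginal_ge0 => x; apply: erase_ge0.
have qm0 i z : 0 <= qm i z by apply: block_marginal_ge0 => x; apply: erase_ge0.
apply: le_trans (bhattacharyya_erase B p0 q0) _.
apply: le_trans (bhattacharyya_le (expR_ge0 _) _ p_le) _.
  by move=> x; apply: erase_ge0.
rewrite (funext q_prod) bhattacharyya_prod // sqrtr_expR.
apply: le_trans (ler_wpM2l (expR_ge0 _) (prod_bhattacharyya_le _ c_le)) _.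
  exact: ltr_wpDr.
by rewrite -expRD ler_expR; lra.
Qed.

Local Open Scope classical_set_scope.
Local Open Scope ring_scope.

Lemma Theta_expR (R : realType) (m : nat -> nat) (c : R) :
  0 < c ->
  (fun n => (m n)%:R : R^o) =Theta_\oo (fun n => n%:R : R^o) ->
  exists a : R, 0 < a /\
    \forall n \near \oo,
      expR (- (c * (m n)%:R / 2)) <= expR (- (a * n%:R)) /\
      expR (a * n%:R) <= expR (2 * c * (m n)%:R).
Proof.
move=> c0; rewrite Theta_sym eqThetaE bigThetaE eqO_exP => -[[k k0 n_le] _].
(* Here [k] is such that [n <= k * m n] eventually, so that [a * n <= c * m n / 2]; the second bound
   follows since [c * m n / 2 <= 2 * c * m n]. *)
exists (c / (2 * k)); split; first by rewrite divr_gt0 ?mulr_gt0.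
apply: filterS n_le => n; rewrite /= !normr_nat !ler_expR => n_le.
have an : c / (2 * k) * n%:R <= c * (m n)%:R / 2.
  rewrite (_ : c * _ / 2 = c / (2 * k) * (k * (m n)%:R)).
    by rewrite ler_wpM2l // divr_ge0 ?mulr_ge0 ?ltW.
  by field; rewrite gt_eqF.
have cm : 0 <= c * (m n)%:R by rewrite mulr_ge0 // ltW.
by split; lra.
Qed.

Theorem theorem2 (R : realType)
    (d r l b : nat)
    (m g : nat -> nat)
    (circ : forall n, circuit R n)
    (inp : forall n, 'I_n -> bool -> R[i])
    (phi0 : forall n, state R n)
    (blk : forall n, block_layout n (m n) b (g n))
    (circ_local : forall n, local_circuit r d (circ n))
    (inp_normalized : forall n (i : 'I_n), normalized (inp n i))
    (phi0_normalized : forall n, normalized (phi0 n))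
    (l_scale : forall n, light_cone_scale l (circ n))
    (g_gt_l : forall n, (l < g n)%N)
    (m_Theta : (fun n => (m n)%:R : R^o) =Theta_\oo (fun n => n%:R : R^o)) :
  let p n := born (phi0 n) in
  let q n := born (run (circ n) (product_state (inp n))) in
  let pbar n := erase (blk n) (p n) in
  let qbar n := erase (blk n) (q n) in
  let pm n (i : 'I_(m n)) := block_marginal (pbar n) i in
  let qm n (i : 'I_(m n)) := block_marginal (qbar n) i in
  (forall n (x : {ffun 'I_(m n) -> bits b}),
     qbar n x = \prod_(i < m n) qm n i (x i)) /\
  (forall (chi c : R) (n0 : nat),
     0 <= chi -> 0 < c ->
     (forall n, (n0 <= n)%N -> forall x : {ffun 'I_(m n) -> bits b},
        pbar n x <= expR (chi * (m n)%:R) * \prod_(i < m n) pm n i (x i)) ->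
     (forall n, (n0 <= n)%N ->
        (c%:E <= (((m n)%:R : R)^-1)%:E
                   * (\sum_(i < m n) renyi_half (pm n i) (qm n i))
                 - chi%:E)%E) ->
     (forall n, (n0 <= n)%N ->
        bhattacharyya (p n) (q n) <= expR (- (c * (m n)%:R / 2)) /\
        ((expR (2 * c * (m n)%:R))%:E <= dnp_dynamic_range (p n) (q n))%E) /\
     (exists a : R, 0 < a /\
        \forall n \near \oo,
          expR (- (c * (m n)%:R / 2)) <= expR (- (a * n%:R)) /\
          expR (a * n%:R) <= expR (2 * c * (m n)%:R))).
Proof.
move=> p q pbar qbar pm qm.
have q0 n s : 0 <= q n s by apply: born_ge0.
have q1 n : \sum_s q n s = 1 by apply: sum_born_run.
have q_prod n x : qbar n x = \prod_(i < m n) qm n i (x i).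
  apply: (erase_prod (l := l)) => // A A' E F AA' EA FA'.
  apply: born_run_indep EA FA' => //; last exact: l_scale.
  by have [] := circ_local n.
split=> // chi c n0 chi0 c0 p_le c_le; split; last exact: Theta_expR.
move=> n n0n.
have Bn : bhattacharyya (p n) (q n) <= expR (- (c * (m n)%:R / 2)).
  apply: (bhattacharyya_blocks_le _ (q0 n) chi0 c0 (q_prod n) (p_le n n0n)
    (c_le n n0n)).
  by move=> s; apply: born_ge0.
(* With [a = c * m n / 2] the exponent [4 * a] is [2 * c * m n]. *)
split=> //; have := dnp_dynamic_range_ge (q0 n) (q1 n) Bn.
by congr (_%:E <= _)%E; congr expR; field.
Qed.
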